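(* Let $(A,D(A))$ be the generator of a strongly continuous semigroup $(T(t))_{t\ge 0}$ on a complex Banach space $X$. Then for every $\lambda\in\mathbb{C}$ and every $t>0$: (1) $K(e^{\lambda t}I-T(t))\subseteq K(\lambda I-A)$; (2) $C(e^{\lambda t}I-T(t))\subseteq C(\lambda I-A)$.
   Context: The generator of a strongly continuous semigroup $(T(t))_{t\ge0}$ is $Ax=\lim_{s\downarrow0}\frac{T(s)x-x}{s}$ with domain $D(A)$ the set of $x\in X$ for which the limit exists. For a linear operator $S$ on $X$ with domain $D(S)\subseteq X$ ($D(S)=X$ if $S$ is bounded), the algebraic core is $$C(S)=\{x\in X:\ \exists (x_n)_{n\ge0}\subset X,\ x_0=x,\ x_n\in D(S)\text{ and } Sx_n=x_{n-1}\ \forall n\ge1\},$$ and the analytic core is $$K(S)=\{x\in X:\ \exists (x_n)_{n\ge0}\subset X \text{ and } \delta>0,\ x_0=x,\ x_n\in D(S),\ Sx_n=x_{n-1}\text{ and } \|x_n\|\le\delta^n\|x\|\ \forall n\ge1\}.$$ Here $D(\lambda I-A)=D(A)$. *)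

(* Defs.v *)
(* Stdlib reals with Coquelicot; a complex Banach space is a
   [CompleteNormedModule C_AbsRing]. *)
From Stdlib Require Export Reals.
From Coquelicot Require Export Coquelicot.
Open Scope R_scope.

Set Implicit Arguments.
Unset Strict Implicit.

Definition Cexp (z : C) : C :=
  (exp (Re z) * cos (Im z), exp (Re z) * sin (Im z)).

(* An operator S with domain D(S); the values of [app] outside [dom] are
   irrelevant.  Linearity is not a field: it holds automatically for the
   operators considered here, namely generators of semigroups, bounded linear
   operators, and the operators [scalar_minus mu S] formed from these. *)
Record operator (X : Type) : Type := Operator {
  dom : X -> Prop;
  app : X -> X
}.

Definition everywhere_defined (X : Type) (f : X -> X) : operator X :=
  {| dom := fun _ => True; app := f |}.

(* mu I - S, with domain D(S). *)
Definition scalar_minus (X : NormedModule C_AbsRing) (mu : C) (S : operator X) :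
    operator X :=
  {| dom := dom S; app := fun x => minus (scal mu x) (app S x) |}.

Definition algebraic_core (X : NormedModule C_AbsRing) (S : operator X) (x : X) :
    Prop :=
  exists u : nat -> X,
    u O = x /\
    forall n : nat, (1 <= n)%nat -> dom S (u n) /\ app S (u n) = u (n - 1)%nat.

Definition analytic_core (X : NormedModule C_AbsRing) (S : operator X) (x : X) :
    Prop :=
  exists (u : nat -> X) (delta : R),
    0 < delta /\ u O = x /\
    forall n : nat, (1 <= n)%nat ->
      dom S (u n) /\ app S (u n) = u (n - 1)%nat /\
      norm (u n) <= delta ^ n * norm x.

(* The time parameter ranges over [0, +oo); values at negative times are
   unconstrained.  [is_linear] includes boundedness. *)
Record C0_semigroup (X : NormedModule C_AbsRing) (T : R -> X -> X) : Prop := {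
  C0_linear : forall t, 0 <= t -> is_linear (T t);
  C0_zero : forall x, T 0 x = x;
  C0_plus : forall s t, 0 <= s -> 0 <= t -> forall x, T (s + t) x = T s (T t x);
  C0_continuous : forall x t, 0 <= t ->
    filterlim (fun s => T s x) (within (fun s => 0 <= s) (locally t))
              (locally (T t x))
}.

Definition is_generator_limit (X : NormedModule C_AbsRing) (T : R -> X -> X)
    (x y : X) : Prop :=
  filterlim (fun s : R => scal (RtoC (/ s)) (minus (T s x) x))
            (at_right 0) (locally y).

Definition is_generator (X : NormedModule C_AbsRing) (T : R -> X -> X)
    (A : operator X) : Prop :=
  (forall x, dom A x <-> exists y, is_generator_limit T x y) /\
  (forall x, dom A x -> is_generator_limit T x (app A x)).

(* Main.v *)
Require Import Defs.
From Stdlib Require Import Lra Lia Classical ClassicalEpsilon.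

(** The operator [S = Cexp (lambda t) I - T t] factors through [lambda I - A].  Put
    [B x] for the integral over [0, t] of [Cexp (lambda (t - s)) (T s x)] in [s].  Then
    [B x] lies in the domain of [A], [(lambda I - A) (B x) = S x], and [B] is bounded and
    commutes with [S] ([scalar_minus_factorization]).  If [u] is a backward orbit of [S]
    starting at [x], then [v n = B^n (u n)] is a backward orbit of [lambda I - A]
    starting at the same point ([iterated_preimages]), which settles the algebraic
    core.  If moreover [norm (u n) <= delta^n * norm x] and [norm (B y) <= M * norm y]
    for all [y], then [norm (v n) <= (M * delta)^n * norm x], which settles the analytic
    core.

    For the factorization, [U s = Cexp (- lambda s) T s] is again a strongly continuous
    semigroup ([rescale_C0_semigroup]), and its generator is [A - lambda I]
    ([rescale_generator_limit]).  It suffices that the integral [J x] over [0, t] of an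
    orbit of [U] lies in the domain of that generator and is mapped to [U t x - x]
    ([orbit_integral_generator]); this is the fundamental theorem of calculus applied
    to an integral whose two end points move together.

    That [B] is bounded depends on a bound for [T s] which is uniform in [s] over
    [0, t].  It is obtained from the principle of uniform boundedness
    ([uniform_boundedness]), since every orbit is continuous and hence bounded
    on [0, t]. *)

(** * Norms and linear maps *)

(** Unfolding [minus] leaves an expanded group structure on which the lemmas about
    [plus] do not rewrite; this equation avoids it. *)
Lemma minusE : forall {G : AbelianGroup} (x y : G), minus x y = plus x (opp y).
Proof. reflexivity. Qed.

Lemma minus_plus_opp : forall {G : AbelianGroup} (x y : G), minus x (plus x (opp y)) = y.
Proof.
  intros G x y. now rewrite minusE, opp_plus, opp_opp, plus_assoc, plus_opp_r, plus_zero_l.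
Qed.

Lemma minus_plus_plus :
  forall {G : AbelianGroup} (a b c d : G),
    minus (plus a b) (plus c d) = plus (minus a c) (minus b d).
Proof.
  intros G a b c d. rewrite !minusE, opp_plus, <- !plus_assoc. f_equal.
  rewrite !plus_assoc. f_equal. apply plus_comm.
Qed.

Lemma plus_minus_cancel :
  forall {K : AbsRing} {V : NormedModule K} (x y : V), minus (plus x y) y = x.
Proof.
  intros K V x y. now rewrite minusE, <- plus_assoc, plus_opp_r, plus_zero_r.
Qed.

Lemma norm_minus_le :
  forall {K : AbsRing} {V : NormedModule K} (x y : V),
    norm (minus x y) <= norm x + norm y.
Proof.
  intros K V x y. rewrite minusE, <- (norm_opp y). apply @norm_triangle.
Qed.

Lemma norm_minus_diag :
  forall {K : AbsRing} {V : NormedModule K} (x : V), norm (minus x x) = 0.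
Proof.
  intros K V x. rewrite minus_eq_zero. apply @norm_zero.
Qed.

Lemma norm_minus_trans :
  forall {K : AbsRing} {V : NormedModule K} (y x z : V),
    norm (minus x z) <= norm (minus x y) + norm (minus y z).
Proof.
  intros K V y x z. rewrite (minus_trans y). apply @norm_triangle.
Qed.

Lemma norm_minus_sym :
  forall {K : AbsRing} {V : NormedModule K} (x y : V),
    norm (minus x y) = norm (minus y x).
Proof. intros K V x y. now rewrite <- opp_minus, norm_opp. Qed.

Lemma norm_scal_R :
  forall {V : NormedModule R_AbsRing} (a : R) (x : V),
    norm (scal a x) <= Rabs a * norm x.
Proof. intros V a x. exact (norm_scal a x). Qed.

Lemma is_linear_minus :
  forall (X : NormedModule C_AbsRing) (L1 L2 : X -> X),
    is_linear L1 -> is_linear L2 -> is_linear (fun x => minus (L1 x) (L2 x)).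
Proof.
  intros X L1 L2 H1 H2. split.
  - intros x y. rewrite (linear_plus _ H1), (linear_plus _ H2).
    exact (minus_plus_plus (G := X) (L1 x) (L1 y) (L2 x) (L2 y)).
  - intros k x. rewrite (linear_scal _ H1), (linear_scal _ H2).
    symmetry. exact (scal_minus_distr_l k (L1 x) (L2 x)).
  - destruct (linear_norm _ H1) as (M1 & HM1 & HL1).
    destruct (linear_norm _ H2) as (M2 & HM2 & HL2).
    exists (M1 + M2). split; [lra|]. intros x.
    eapply Rle_trans; [apply norm_minus_le|].
    rewrite Rmult_plus_distr_r. apply Rplus_le_compat; auto.
Qed.

Lemma is_linear_scal_C :
  forall (X : NormedModule C_AbsRing) (c : C) (L : X -> X),
    is_linear L -> is_linear (fun x => scal c (L x)).
Proof.
  intros X c L HL. split.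
  - intros x y. rewrite (linear_plus L HL). exact (scal_distr_l (c : C_AbsRing) (L x) (L y)).
  - intros k x. rewrite (linear_scal L HL), !scal_assoc. f_equal. apply Cmult_comm.
  - destruct (linear_norm L HL) as (M & HM & H).
    exists ((Cmod c + 1) * M). generalize (Cmod_ge_0 c); intros Hc. split.
    + apply Rmult_lt_0_compat; lra.
    + intros x. eapply Rle_trans; [apply (norm_scal (V := X))|].
      change (abs c) with (Cmod c). rewrite Rmult_assoc.
      apply Rmult_le_compat; [lra | apply norm_ge_0 | lra | apply H].
Qed.

(** * The principle of uniform boundedness *)

(** A bound on one ball, wherever centred, is a bound everywhere: a vector [y] of
    norm at most [r] is the difference of [y + c] and [c], so its image has norm at
    most [2 * K], and homogeneity does the rest. *)
Lemma linear_bounded_of_bounded_on_ball :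
  forall (V W : NormedModule R_AbsRing) (I : Type) (L : I -> V -> W) (c : V) (r K : R),
    (forall i, is_linear (L i)) -> 0 < r -> 0 <= K ->
    (forall i (x : V), norm (minus x c) <= r -> norm (L i x) <= K) ->
    forall i (x : V), norm (L i x) <= (2 * K / r) * norm x.
Proof.
  intros V W I L c r K HL Hr HK Hb i x.
  destruct (Req_dec (norm x) 0) as [Hx | Hx].
  - rewrite (norm_eq_zero x Hx), (linear_zero _ (HL i)), !norm_zero. lra.
  - assert (Hx' : 0 < norm x) by (generalize (norm_ge_0 x); lra).
    set (y := scal (r / norm x) x : V).
    assert (Hy : norm y <= r).
    { unfold y. eapply Rle_trans. apply norm_scal_R.
      rewrite Rabs_pos_eq.
      - right. field. lra.
      - apply Rlt_le, Rdiv_lt_0_compat; lra. }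
    assert (H1 : norm (L i (plus y c)) <= K).
    { apply Hb. rewrite plus_minus_cancel. exact Hy. }
    assert (H2 : norm (L i c) <= K).
    { apply Hb. rewrite norm_minus_diag. lra. }
    assert (H3 : norm (L i y) <= 2 * K).
    { replace (L i y) with (minus (L i (plus y c)) (L i c)).
      - eapply Rle_trans. apply norm_minus_le. lra.
      - now rewrite (linear_plus _ (HL i)), plus_minus_cancel. }
    assert (H4 : L i x = scal (norm x / r) (L i y)).
    { unfold y. rewrite (linear_scal _ (HL i)), scal_assoc.
      replace (mult (norm x / r) (r / norm x)) with (one : R_AbsRing).
      - now rewrite scal_one.
      - unfold mult, one; simpl. field. lra. }
    rewrite H4. eapply Rle_trans. apply norm_scal_R.
    rewrite Rabs_pos_eq by (apply Rlt_le, Rdiv_lt_0_compat; lra).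
    replace (2 * K / r * norm x) with (norm x / r * (2 * K)) by (field; lra).
    apply Rmult_le_compat_l; [apply Rlt_le, Rdiv_lt_0_compat; lra | exact H3].
Qed.

(** The part of Baire's theorem needed for uniform boundedness: the centres form a
    Cauchy sequence because the radii at least halve, and each closed ball contains
    the limit because it contains all later centres. *)
Lemma nested_balls_intersect :
  forall (V : CompleteNormedModule R_AbsRing) (c : nat -> V) (r : nat -> R),
    (forall n, 0 < r n) ->
    (forall n (x : V), norm (minus x (c (S n))) <= r (S n) -> norm (minus x (c n)) <= r n) ->
    (forall n, r (S n) <= r n / 2) ->
    exists z, forall n, norm (minus z (c n)) <= r n.
Proof.
  intros V c r Hr Hnest Hhalf.
  assert (Hn : forall n k (x : V), norm (minus x (c (n + k)%nat)) <= r (n + k)%nat ->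
                 norm (minus x (c n)) <= r n).
  { intros n k; induction k as [|k IH]; intros x Hx.
    - now rewrite Nat.add_0_r in Hx.
    - apply IH, Hnest. now rewrite Nat.add_succ_r in Hx. }
  assert (Hc : forall n m, (n <= m)%nat -> norm (minus (c m) (c n)) <= r n).
  { intros n m Hnm. apply (Hn n (m - n)%nat).
    replace (n + (m - n))%nat with m by lia.
    rewrite (norm_minus_diag (V := V)). apply Rlt_le, Hr. }
  assert (Hgeo : forall n, r n <= r O * (1 / 2) ^ n).
  { induction n as [|n IH]; simpl; [lra|]. generalize (Hhalf n); lra. }
  set (F := filtermap c eventually).
  assert (HF : ProperFilter F) by (apply filtermap_proper_filter, eventually_filter).
  assert (HC : cauchy F).
  { intros eps.
    destruct (pow_lt_1_zero (1 / 2) ltac:(rewrite Rabs_pos_eq; lra) (eps / r O)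
                ltac:(apply Rdiv_lt_0_compat; [apply cond_pos | apply Hr])) as [N HN].
    exists (c N), N. intros m Hm. apply (norm_compat1 (V := V)).
    eapply Rle_lt_trans. now apply Hc.
    eapply Rle_lt_trans. apply Hgeo.
    specialize (HN N (le_n _)).
    apply Rle_lt_trans with (r O * Rabs ((1 / 2) ^ N)).
    { apply Rmult_le_compat_l; [apply Rlt_le, Hr | apply Rle_abs]. }
    apply Rmult_lt_compat_l with (r := r O) in HN; [|apply Hr].
    replace (r O * (eps / r O)) with (pos eps) in HN; [exact HN|].
    field. apply Rgt_not_eq, Hr. }
  exists (lim F). intros n. apply le_epsilon. intros e He.
  assert (Hf := @norm_factor_gt_0 _ V).
  set (d := mkposreal (e / (@norm_factor _ V)) (Rdiv_lt_0_compat _ _ He Hf)).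
  destruct (complete_cauchy F HF HC d) as [N HN].
  specialize (HN (max n N) (Nat.le_max_r _ _)).
  apply (norm_compat2 (V := V)) in HN. simpl in HN.
  replace (@norm_factor _ V * (e / @norm_factor _ V)) with e in HN by (field; lra).
  eapply Rle_trans; [exact (norm_minus_trans (V := V) (c (max n N)) (lim F) (c n))|].
  rewrite (norm_minus_sym (V := V) (lim F)), Rplus_comm.
  apply Rplus_le_compat; [now apply Hc, Nat.le_max_l | now apply Rlt_le].
Qed.

(** If no common bound exists, then by [linear_bounded_of_bounded_on_ball] the family
    is unbounded on every ball, so inside any ball there is a smaller one on which
    some member of the family has norm at least [n].  A point common to a nested
    sequence of such balls contradicts pointwise boundedness. *)
Theorem uniform_boundedness :
  forall (V : CompleteNormedModule R_AbsRing) (W : NormedModule R_AbsRing)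
         (I : Type) (L : I -> V -> W),
    (forall i, is_linear (L i)) ->
    (forall x, exists M, forall i, norm (L i x) <= M) ->
    exists M, 0 < M /\ forall i (x : V), norm (L i x) <= M * norm x.
Proof.
  intros V W I L HL Hpt.
  apply NNPP. intros Hnot.
  assert (Hstep : forall (n : nat) (p : V * R), exists q : V * R,
    0 < snd p ->
    0 < snd q /\ snd q <= snd p / 2 /\
    (forall x : V, norm (minus x (fst q)) <= snd q -> norm (minus x (fst p)) <= snd p) /\
    exists i, forall x : V, norm (minus x (fst q)) <= snd q -> INR n <= norm (L i x)).
  { intros n [c r]; simpl.
    destruct (Rlt_dec 0 r) as [Hr|Hr]; [|exists (c, r); simpl; intros; lra].
    assert (Hex : exists i (x : V), norm (minus x c) <= r / 2 /\ INR n + 1 < norm (L i x)).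
    { apply NNPP. intros Hno. apply Hnot.
      assert (HK : 0 <= INR n + 1) by (generalize (pos_INR n); lra).
      assert (Hb := @linear_bounded_of_bounded_on_ball V W I L c (r / 2) (INR n + 1) HL
                      ltac:(lra) HK).
      exists (2 * (INR n + 1) / (r / 2) + 1). split.
      { assert (0 <= 2 * (INR n + 1) / (r / 2)); [|lra].
        apply Rdiv_le_0_compat; lra. }
      intros i x. eapply Rle_trans.
      - apply Hb. intros j y Hy. apply Rnot_lt_le. intros Hlt. apply Hno. eauto.
      - apply Rmult_le_compat_r; [apply norm_ge_0 | lra]. }
    destruct Hex as (i & y & Hy & Hbig).
    destruct (linear_norm _ (HL i)) as (M & HM & HLM).
    assert (HiM : 0 < / M) by now apply Rinv_0_lt_compat.
    (* Radius [r / 2] keeps the new ball inside the old one; radius [1 / M] lets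
       [L i] vary by at most 1 on it, which the margin in [INR n + 1] absorbs. *)
    exists (y, Rmin (r / 2) (/ M)); simpl. intros _.
    assert (H1 := Rmin_l (r / 2) (/ M)). assert (H2 := Rmin_r (r / 2) (/ M)).
    repeat split; try lra.
    - apply Rmin_glb_lt; lra.
    - intros x Hx.
      assert (H : norm (minus x c) <= norm (minus x y) + norm (minus y c))
        by exact (norm_minus_trans (V := V) y x c).
      lra.
    - exists i. intros x Hx.
      assert (H3 : norm (L i (minus x y)) <= 1).
      { eapply Rle_trans. apply HLM.
        replace 1 with (M * / M) by (field; lra).
        apply Rmult_le_compat_l; lra. }
      rewrite (linear_minus _ _ _ (HL i)) in H3.
      generalize (norm_triangle_inv (L i x) (L i y)).
      generalize (Rabs_maj2 (norm (L i x) - norm (L i y))). lra. }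
  pose (next := fun n p => proj1_sig (constructive_indefinite_description _ (Hstep n p))).
  pose (s := fix s n := match n with O => (zero, 1) | S m => next m (s m) end).
  assert (Hs : forall n, 0 < snd (s n) -> _) by
    (intros n; exact (proj2_sig (constructive_indefinite_description _ (Hstep n (s n))))).
  assert (Hpos : forall n, 0 < snd (s n)).
  { induction n as [|n IH]; simpl; [lra|]. now apply Hs. }
  destruct (@nested_balls_intersect V (fun n => fst (s n)) (fun n => snd (s n)) Hpos)
    as [z Hz].
  - intros n. now apply Hs.
  - intros n. now apply Hs.
  - destruct (Hpt z) as [M HM].
    destruct (INR_unbounded M) as [n Hn].
    destruct (Hs n (Hpos n)) as (_ & _ & _ & i & Hi).
    specialize (Hi z (Hz (S n))). specialize (HM i). lra.
Qed.

(** * Restriction of scalars to the real numbers *)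

(** The Riemann integral takes its values in normed modules over the real numbers.
    Restricting the scalars keeps the carrier, the norm and the uniform structure, so
    that statements about [X] and about [realify X] are convertible; the proofs below
    move between the two silently. *)
Definition realify_scal (X : NormedModule C_AbsRing) : ModuleSpace.mixin_of R_Ring X.
Proof.
  apply (ModuleSpace.Mixin R_Ring X (fun (a : R) (x : X) => scal (RtoC a) x)).
  - intros a b x.
    replace (RtoC (mult a b)) with (mult (RtoC a : C_AbsRing) (RtoC b : C_AbsRing)).
    + exact (scal_assoc (RtoC a : C_AbsRing) (RtoC b) x).
    + symmetry. apply RtoC_mult.
  - intros x. exact (scal_one x).
  - intros a x y. exact (scal_distr_l (RtoC a : C_AbsRing) x y).
  - intros a b x.
    replace (RtoC (plus a b)) with (plus (RtoC a : C_AbsRing) (RtoC b : C_AbsRing)).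
    + exact (scal_distr_r (RtoC a : C_AbsRing) (RtoC b) x).
    + symmetry. apply RtoC_plus.
Defined.

Definition realify (X : CompleteNormedModule C_AbsRing) : CompleteNormedModule R_AbsRing.
Proof.
  pose (N := NormedModuleAux.Pack R_AbsRing X
    (NormedModuleAux.Class R_AbsRing X
      (ModuleSpace.Class R_Ring X (AbelianGroup.class X) (realify_scal X))
      (UniformSpace.class X)) X).
  refine (CompleteNormedModule.Pack R_AbsRing X
    (CompleteNormedModule.Class R_AbsRing X
      (NormedModule.Class R_AbsRing X (NormedModuleAux.class R_AbsRing N)
        (NormedModule.Mixin R_AbsRing N (fun x => norm (x : X)) (@norm_factor _ X)
          _ _ _ _ _))
      (CompleteSpace.class X)) X).
  - exact (norm_triangle (V := X)).
  - intros a x. rewrite <- Cmod_R. exact (norm_scal (RtoC a) (x : X)).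
  - exact (norm_compat1 (V := X)).
  - exact (norm_compat2 (V := X)).
  - exact (norm_eq_zero (V := X)).
Defined.

Lemma is_linear_realify :
  forall (X : CompleteNormedModule C_AbsRing) (L : X -> X),
    is_linear L -> is_linear (U := realify X) (V := realify X) L.
Proof.
  intros X L HL. split.
  - exact (linear_plus L HL).
  - intros a x. exact (linear_scal L HL (RtoC a) x).
  - exact (linear_norm L HL).
Qed.

(** * Integrals and derivatives of vector-valued functions *)

Lemma Riemann_sum_linear :
  forall (V W : NormedModule R_AbsRing) (L : V -> W) (f : R -> V) (p : SF_seq),
    is_linear L -> Riemann_sum (fun s => L (f s)) p = L (Riemann_sum f p).
Proof.
  intros V W L f p HL.
  apply SF_cons_ind with (s := p).
  - intros x0. symmetry. exact (linear_zero L HL).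
  - intros h p' IH. rewrite !Riemann_sum_cons, IH.
    rewrite (linear_plus L HL), (linear_scal L HL). reflexivity.
Qed.

(** Bounded linear maps commute with the integral because they commute with Riemann
    sums and are continuous. *)
Lemma is_RInt_linear :
  forall (V W : NormedModule R_AbsRing) (L : V -> W) (f : R -> V) (a b : R) (l : V),
    is_linear L -> is_RInt f a b l -> is_RInt (fun s => L (f s)) a b (L l).
Proof.
  intros V W L f a b l HL Hf. unfold is_RInt.
  apply filterlim_ext with (fun p => L (scal (sign (b - a)) (Riemann_sum f p))).
  - intros p. now rewrite (linear_scal L HL), (Riemann_sum_linear V W L).
  - eapply filterlim_comp; [exact Hf | now apply linear_cont].
Qed.

(** The generator is defined by a difference quotient, whereas the fundamental
    theorem of calculus yields a derivative in the sense of [is_derive]. *)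
Lemma is_derive_difference_quotient :
  forall (V : NormedModule R_AbsRing) (f : R -> V) (l : V),
    is_derive f 0 l ->
    filterlim (fun h => scal (/ h) (minus (f h) (f 0))) (at_right 0) (locally l).
Proof.
  intros V f l [_ Hf].
  apply (filterlim_locally_ball_norm (K := R_AbsRing)). intros eps.
  specialize (Hf 0 (fun P H => H)).
  assert (He : 0 < eps / 2) by (generalize (cond_pos eps); lra).
  specialize (Hf (mkposreal _ He)). revert Hf.
  unfold at_right, within. apply filter_imp. intros h Hh Hpos. simpl in Hh.
  set (D := minus (minus (f h) (f 0)) (scal h l)).
  assert (HD : norm D <= eps / 2 * h).
  { change (norm (minus (minus (f h) (f 0)) (scal (h - 0) l)) <= eps / 2 * Rabs (h - 0))
      in Hh.
    rewrite Rminus_0_r, (Rabs_pos_eq h) in Hh by lra. exact Hh. }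
  assert (E : minus (scal (/ h) (minus (f h) (f 0))) l = scal (/ h) D).
  { unfold D. rewrite (scal_minus_distr_l (/ h) (minus (f h) (f 0))), scal_assoc.
    replace (mult (/ h) h) with (one : R_AbsRing).
    - now rewrite scal_one.
    - unfold mult, one; simpl. field. lra. }
  change (norm (minus (scal (/ h) (minus (f h) (f 0))) l) < eps).
  rewrite E. eapply Rle_lt_trans; [apply norm_scal_R|].
  rewrite Rabs_pos_eq by now apply Rlt_le, Rinv_0_lt_compat.
  apply Rle_lt_trans with (/ h * (eps / 2 * h)).
  - apply Rmult_le_compat_l; [now apply Rlt_le, Rinv_0_lt_compat | exact HD].
  - replace (/ h * (eps / 2 * h)) with (eps / 2) by (field; lra).
    generalize (cond_pos eps); lra.
Qed.

(** * Integrals along the orbits of a semigroup *)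

(** Extending the orbit to negative times by its value at time 0 makes it continuous
    on the whole line, so that integrability needs no one-sided argument. *)
Definition orbit (X : CompleteNormedModule C_AbsRing) (T : R -> X -> X) (x : X)
    (s : R) : realify X :=
  T (Rmax 0 s) x.

Definition orbit_integral (X : CompleteNormedModule C_AbsRing) (T : R -> X -> X)
    (t : R) (x : X) : X :=
  RInt (orbit X T x) 0 t.

Lemma orbit_eq :
  forall (X : CompleteNormedModule C_AbsRing) (T : R -> X -> X) (x : X) (s : R),
    0 <= s -> orbit X T x s = T s x.
Proof.
  intros X T x s Hs. unfold orbit. now rewrite Rmax_right.
Qed.

Lemma orbit_continuous :
  forall (X : CompleteNormedModule C_AbsRing) (T : R -> X -> X),
    C0_semigroup T -> forall (x : X) (s : R), continuous (orbit X T x) s.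
Proof.
  intros X T HT x s. unfold continuous, orbit.
  apply (filterlim_comp _ _ _ (Rmax 0) (fun r => T r x) (locally s)
           (within (fun r => 0 <= r) (locally (Rmax 0 s))));
    [|apply (C0_continuous HT), Rmax_l].
  intros P [d Hd]. exists d. intros y Hy. apply Hd; [|apply Rmax_l].
  unfold ball, UniformSpace.ball, UniformSpace.class in *; simpl in *.
  unfold AbsRing_ball, abs, minus, plus, opp in *; simpl in *.
  apply Rabs_def2 in Hy. apply Rabs_def1;
  unfold Rmax; repeat destruct Rle_dec; lra.
Qed.

Lemma is_RInt_orbit :
  forall (X : CompleteNormedModule C_AbsRing) (T : R -> X -> X),
    C0_semigroup T -> forall (x : X) (a b : R),
    is_RInt (orbit X T x) a b (RInt (orbit X T x) a b).
Proof.
  intros X T HT x a b. apply (RInt_correct (V := realify X)).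
  apply (ex_RInt_continuous (V := realify X)). intros z _.
  now apply orbit_continuous.
Qed.

(** With [L] the operator [Cexp (lambda t) I - T t], this is what makes the factor [B] of
    [scalar_minus_factorization] commute with [L]. *)
Lemma orbit_integral_commute :
  forall (X : CompleteNormedModule C_AbsRing) (T : R -> X -> X) (L : X -> X) (t : R),
    C0_semigroup T -> is_linear L -> 0 <= t ->
    (forall s x, 0 <= s -> L (T s x) = T s (L x)) ->
    forall x, L (orbit_integral X T t x) = orbit_integral X T t (L x).
Proof.
  intros X T L t HT HL Ht Hcomm x. symmetry.
  apply (is_RInt_unique (V := realify X)).
  apply (is_RInt_ext (V := realify X) (fun s => L (orbit X T x s))).
  - intros s _. apply Hcomm, Rmax_l.
  - apply (is_RInt_linear (realify X) (realify X) L).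
    + now apply is_linear_realify.
    + now apply is_RInt_orbit.
Qed.

(** Each orbit is continuous, hence bounded on the compact interval; by
    [uniform_boundedness] the bound is then proportional to the norm of the initial
    vector. *)
Lemma C0_semigroup_locally_bounded :
  forall (X : CompleteNormedModule C_AbsRing) (T : R -> X -> X) (t : R),
    C0_semigroup T ->
    exists M, 0 < M /\ forall s x, 0 <= s <= t -> norm (T s x) <= M * norm x.
Proof.
  intros X T t HT.
  destruct (uniform_boundedness (realify X) (realify X) {s : R | 0 <= s <= t}
              (fun s => T (proj1_sig s))) as (M & HM & H).
  - intros [s Hs]. apply is_linear_realify. now apply (C0_linear HT).
  - intros x.
    destruct (bounded_continuity (V := realify X) (orbit X T x) 0 t) as [M HM].
    + intros s _. now apply orbit_continuous.
    + exists M. intros [s Hs]; simpl. apply Rlt_le.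
      rewrite <- orbit_eq by lra. now apply HM.
  - exists M. split; [exact HM|]. intros s x Hs. exact (H (exist _ s Hs) x).
Qed.

Lemma orbit_integral_bounded :
  forall (X : CompleteNormedModule C_AbsRing) (T : R -> X -> X) (t : R),
    C0_semigroup T -> 0 < t ->
    exists M, 0 < M /\ forall x, norm (orbit_integral X T t x) <= M * norm x.
Proof.
  intros X T t HT Ht.
  destruct (C0_semigroup_locally_bounded X T t HT) as (M & HM & H).
  exists (t * M). split; [now apply Rmult_lt_0_compat|].
  intros x. rewrite Rmult_assoc. replace t with (t - 0) at 2 by lra.
  refine (norm_RInt_le_const (V := realify X) (orbit X T x) 0 t _ _ _ _ _).
  - lra.
  - intros s Hs. rewrite orbit_eq by lra. now apply H.
  - now apply is_RInt_orbit.
Qed.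

(** By the semigroup law, [T h] maps the integral of the orbit over [0, t] to the
    integral over [h, t + h].  The difference quotient at [h = 0] therefore converges
    to the difference of the integrand at the two end points. *)
Lemma orbit_integral_generator :
  forall (X : CompleteNormedModule C_AbsRing) (T : R -> X -> X) (t : R) (x : X),
    C0_semigroup T -> 0 < t ->
    is_generator_limit T (orbit_integral X T t x) (minus (T t x) x).
Proof.
  intros X T t x HT Ht.
  set (F := fun h => RInt (orbit X T x) h (t + h) : realify X).
  assert (HF : forall h, 0 <= h -> F h = T h (orbit_integral X T t x)).
  { intros h Hh. symmetry. unfold F.
    transitivity (RInt (V := realify X) (fun s => T h (orbit X T x s)) 0 t).
    - symmetry. apply (is_RInt_unique (V := realify X)).
      apply (is_RInt_linear (realify X) (realify X) (T h)).
      + now apply is_linear_realify, (C0_linear HT).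
      + now apply is_RInt_orbit.
    - apply (is_RInt_unique (V := realify X)).
      (* The integrand has the shape of a substitution by [s |-> 1 * s + h]. *)
      apply (is_RInt_ext (V := realify X) (fun s => scal 1 (orbit X T x (1 * s + h)))).
      + intros s. rewrite Rmin_left, Rmax_right by lra. intros Hs.
        rewrite (scal_one (orbit X T x _ : realify X)).
        rewrite !orbit_eq by lra. rewrite <- (C0_plus HT) by lra. f_equal. lra.
      + apply (is_RInt_comp_lin (V := realify X)).
        replace (1 * 0 + h) with h by lra. replace (1 * t + h) with (t + h) by lra.
        now apply is_RInt_orbit. }
  assert (HD : is_derive F 0 (minus (scal 1 (orbit X T x (t + 0)))
                                    (scal 1 (orbit X T x 0)))).
  { apply (is_derive_RInt_bound_comp (V := realify X) (orbit X T x)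
       (fun a b => RInt (orbit X T x) a b) (fun h => h) (fun h => t + h)).
    - apply filter_forall. intros u. now apply is_RInt_orbit.
    - now apply orbit_continuous.
    - now apply orbit_continuous.
    - auto_derive; [easy | ring].
    - auto_derive; [easy | ring]. }
  apply is_derive_difference_quotient in HD.
  replace (minus (T t x) x) with
    (minus (scal 1 (orbit X T x (t + 0))) (scal 1 (orbit X T x 0))).
  - refine (filterlim_ext_loc _ _ _ HD).
    exists (mkposreal 1 Rlt_0_1). intros h _ Hh.
    rewrite !HF by lra. rewrite (C0_zero HT). reflexivity.
  - rewrite !(scal_one (_ : realify X)), Rplus_0_r, !orbit_eq by lra.
    rewrite (C0_zero HT). reflexivity.
Qed.

(** * The complex exponential *)

Lemma Cexp_plus : forall z w : C, Cexp (z + w)%C = (Cexp z * Cexp w)%C.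
Proof.
  intros [a b] [c d]. unfold Cexp, Cmult, Cplus; simpl.
  rewrite exp_plus, cos_plus, sin_plus. f_equal; ring.
Qed.

Lemma Cexp_0 : Cexp 0 = 1.
Proof.
  unfold Cexp, RtoC; simpl. rewrite exp_0, cos_0, sin_0. f_equal; ring.
Qed.

Lemma Cexp_opp_l : forall z : C, (Cexp (- z) * Cexp z)%C = 1.
Proof.
  intros z. rewrite <- Cexp_plus. replace (- z + z)%C with (RtoC 0) by ring.
  apply Cexp_0.
Qed.

Lemma Cmod_le_Rabs : forall z : C, Cmod z <= Rabs (Re z) + Rabs (Im z).
Proof.
  intros [a b]; simpl.
  replace (a, b) with (RtoC a + RtoC b * Ci)%C
    by (unfold RtoC, Ci, Cplus, Cmult; simpl; f_equal; ring).
  eapply Rle_trans. apply Cmod_triangle.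
  rewrite Cmod_mult, !Cmod_R.
  replace (Cmod Ci) with 1; [lra|].
  unfold Cmod, Ci; simpl. replace (0 * (0 * 1) + 1 * (1 * 1)) with 1 by ring.
  now rewrite sqrt_1.
Qed.

(** The neighbourhoods that scalar multiplication refers to are those of the modulus,
    not of the product structure on pairs of reals. *)
Lemma filterlim_C :
  forall (U : Type) (F : (U -> Prop) -> Prop) (FF : Filter F) (f : U -> C) (z : C),
    filterlim (fun u => Re (f u)) F (locally (Re z)) ->
    filterlim (fun u => Im (f u)) F (locally (Im z)) ->
    filterlim f F (@locally (AbsRing_UniformSpace C_AbsRing) z).
Proof.
  intros U F FF f z HRe HIm.
  apply (filterlim_locally (F := F) (U := AbsRing_UniformSpace C_AbsRing) f). intros eps.
  assert (H1 := proj1 (filterlim_locally (F := F) _ _) HRe (pos_div_2 eps)).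
  assert (H2 := proj1 (filterlim_locally (F := F) _ _) HIm (pos_div_2 eps)).
  generalize (filter_and _ _ H1 H2). clear H1 H2. apply filter_imp. intros u [H1 H2].
  change (Rabs (Re (f u) - Re z) < eps / 2) in H1.
  change (Rabs (Im (f u) - Im z) < eps / 2) in H2.
  change (Cmod (f u - z)%C < eps).
  eapply Rle_lt_trans. apply Cmod_le_Rabs.
  replace (Re (f u - z)%C) with (Re (f u) - Re z) by (unfold Re; simpl; ring).
  replace (Im (f u - z)%C) with (Im (f u) - Im z) by (unfold Im; simpl; ring).
  lra.
Qed.

Lemma Cexp_line_continuous :
  forall (z : C) (s : R),
    filterlim (fun r : R => Cexp (z * RtoC r)) (locally s)
              (@locally (AbsRing_UniformSpace C_AbsRing) (Cexp (z * RtoC s))).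
Proof.
  intros [a b] s. apply filterlim_C; [apply locally_filter| |].
  - refine (ex_derive_continuous (V := R_NormedModule)
             (fun r => Re (Cexp ((a, b) * RtoC r))) s _).
    unfold Cexp; simpl. auto_derive. easy.
  - refine (ex_derive_continuous (V := R_NormedModule)
             (fun r => Im (Cexp ((a, b) * RtoC r))) s _).
    unfold Cexp; simpl. auto_derive. easy.
Qed.

Lemma Cexp_line_derivative_0 :
  forall z : C,
    filterlim (fun r : R => RtoC (/ r) * (Cexp (z * RtoC r) - 1))%C (at_right 0)
              (@locally (AbsRing_UniformSpace C_AbsRing) z).
Proof.
  intros [a b]. apply filterlim_C; [apply at_right_proper_filter| |].
  - apply (filterlim_ext (fun r : R => / r *
      (exp (a * r) * cos (b * r) - exp (a * 0) * cos (b * 0)))).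
    + intros r. unfold Cexp; simpl.
      rewrite !Rmult_0_r, exp_0, cos_0, Rminus_0_r, Rplus_0_l. ring.
    + apply (is_derive_difference_quotient R_NormedModule
               (fun r => exp (a * r) * cos (b * r))).
      auto_derive; [easy|]. rewrite !Rmult_0_r, exp_0, cos_0, sin_0. simpl. ring.
  - apply (filterlim_ext (fun r : R => / r *
      (exp (a * r) * sin (b * r) - exp (a * 0) * sin (b * 0)))).
    + intros r. unfold Cexp; simpl.
      rewrite !Rmult_0_r, exp_0, sin_0, Rminus_0_r, Rplus_0_l. ring.
    + apply (is_derive_difference_quotient R_NormedModule
               (fun r => exp (a * r) * sin (b * r))).
      auto_derive; [easy|]. rewrite !Rmult_0_r, exp_0, cos_0, sin_0. simpl. ring.
Qed.

(** * Rescaled semigroups *)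

Lemma scal_C_comm :
  forall (X : NormedModule C_AbsRing) (c d : C) (x : X),
    scal c (scal d x) = scal d (scal c x).
Proof.
  intros X c d x. rewrite !scal_assoc. f_equal. apply Cmult_comm.
Qed.

(** If [T] has generator [A], then [rescale X mu T] has generator [A + mu I]; with
    [mu = - lambda] this reduces the study of [lambda I - A] to that of a generator. *)
Definition rescale (X : NormedModule C_AbsRing) (mu : C) (T : R -> X -> X)
    (s : R) (x : X) : X :=
  scal (Cexp (mu * RtoC s)) (T s x).

Lemma rescale_commute :
  forall (X : NormedModule C_AbsRing) (mu : C) (T : R -> X -> X) (s t : R) (x : X),
    C0_semigroup T -> 0 <= s -> 0 <= t ->
    T t (rescale X mu T s x) = rescale X mu T s (T t x).
Proof.
  intros X mu T s t x HT Hs Ht. unfold rescale.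
  rewrite (linear_scal _ (C0_linear HT Ht)). f_equal.
  rewrite <- !(C0_plus HT) by assumption. now rewrite Rplus_comm.
Qed.

Lemma rescale_cancel :
  forall (X : NormedModule C_AbsRing) (lambda : C) (T : R -> X -> X) (t : R) (x : X),
    scal (Cexp (lambda * RtoC t)) (rescale X (- lambda) T t x) = T t x.
Proof.
  intros X lambda T t x. unfold rescale. rewrite scal_C_comm, scal_assoc.
  replace (mult (Cexp (- lambda * RtoC t)) (Cexp (lambda * RtoC t))) with (one : C_AbsRing).
  - apply @scal_one.
  - replace (- lambda * RtoC t)%C with (- (lambda * RtoC t))%C by ring.
    symmetry. apply Cexp_opp_l.
Qed.

Lemma rescale_C0_semigroup :
  forall (X : NormedModule C_AbsRing) (mu : C) (T : R -> X -> X),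
    C0_semigroup T -> C0_semigroup (rescale X mu T).
Proof.
  intros X mu T HT. split.
  - intros t Ht. apply is_linear_scal_C. now apply (C0_linear HT).
  - intros x. unfold rescale. rewrite (C0_zero HT).
    replace (mu * RtoC 0)%C with (RtoC 0) by ring. rewrite Cexp_0.
    exact (scal_one x).
  - intros s t Hs Ht x. unfold rescale.
    rewrite (C0_plus HT) by assumption.
    rewrite (linear_scal _ (C0_linear HT Hs)), scal_assoc. f_equal.
    rewrite RtoC_plus.
    replace (mu * (RtoC s + RtoC t))%C with (mu * RtoC s + mu * RtoC t)%C by ring.
    apply Cexp_plus.
  - intros x t Ht. unfold rescale.
    apply (filterlim_comp_2 (G := @locally (AbsRing_UniformSpace C_AbsRing) (Cexp (mu * RtoC t)))
             (H := locally (T t x)) (fun s => Cexp (mu * RtoC s)) (fun s => T s x)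
             (fun c y => scal c y)).
    + eapply filterlim_filter_le_1; [apply filter_le_within|]. apply Cexp_line_continuous.
    + now apply (C0_continuous HT).
    + apply (filterlim_scal (V := X)).
Qed.

(** Product rule at time 0 for [T s x], written as [Cexp (lambda s)] times the rescaled
    orbit. *)
Lemma rescale_generator_limit :
  forall (X : NormedModule C_AbsRing) (lambda : C) (T : R -> X -> X) (x y : X),
    is_generator_limit (rescale X (- lambda) T) x y ->
    is_generator_limit T x (plus (scal lambda x) y).
Proof.
  intros X lambda T x y H. unfold is_generator_limit in *.
  apply (filterlim_ext (fun s : R => plus
    (scal (RtoC (/ s) * (Cexp (lambda * RtoC s) - 1))%C x)
    (scal (Cexp (lambda * RtoC s))
      (scal (RtoC (/ s)) (minus (rescale X (- lambda) T s x) x))))).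
  - intros s.
    set (e := Cexp (lambda * RtoC s)).
    assert (E : scal e (rescale X (- lambda) T s x) = T s x) by apply rescale_cancel.
    rewrite scal_assoc.
    replace (mult e (RtoC (/ s))) with (mult (RtoC (/ s) : C_AbsRing) e) by apply Cmult_comm.
    replace (RtoC (/ s) * (e - 1))%C
      with (mult (RtoC (/ s) : C_AbsRing) (minus e one)) by reflexivity.
    rewrite <- !scal_assoc, <- scal_distr_l. f_equal.
    assert (E2 : scal e (minus (rescale X (- lambda) T s x) x) = minus (T s x) (scal e x)).
    { rewrite <- E. exact (scal_minus_distr_l (e : C_AbsRing) _ _). }
    assert (E3 : scal (minus e one) x = minus (scal e x) x).
    { rewrite <- (scal_one x) at 3. exact (scal_minus_distr_r (e : C_AbsRing) one x). }
    rewrite E2, E3, plus_comm. symmetry. apply @minus_trans.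
  - apply (filterlim_comp_2 (G := locally (scal lambda x)) (H := locally y) _ _ plus).
    + apply (filterlim_comp _ _ _ (fun s : R => RtoC (/ s) * (Cexp (lambda * RtoC s) - 1))%C
               (fun c => scal c x) _ (@locally (AbsRing_UniformSpace C_AbsRing) lambda));
        [apply Cexp_line_derivative_0|].
      apply (filterlim_scal_l (V := X)).
    + replace y with (scal (one : C_AbsRing) y) by apply @scal_one.
      apply (filterlim_comp_2 (G := @locally (AbsRing_UniformSpace C_AbsRing) one)
             (H := locally y) (fun s => Cexp (lambda * RtoC s)) _
             (fun c y => scal c y)).
      * replace (one : C_AbsRing) with (Cexp (lambda * RtoC 0) : C_AbsRing).
        -- eapply filterlim_filter_le_1; [apply filter_le_within|]. apply Cexp_line_continuous.
        -- replace (lambda * RtoC 0)%C with (RtoC 0) by ring. apply Cexp_0.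
      * exact H.
      * apply (filterlim_scal (V := X)).
    + apply (filterlim_plus (V := X)).
Qed.

(** The limit that defines [A] is unique, so [A x] can be read off from any limit that
    is exhibited. *)
Lemma generator_scalar_minus :
  forall (X : NormedModule C_AbsRing) (T : R -> X -> X) (A : operator X)
         (lambda : C) (x y : X),
    is_generator T A ->
    is_generator_limit (rescale X (- lambda) T) x (opp y) ->
    dom A x /\ app (scalar_minus lambda A) x = y.
Proof.
  intros X T A lambda x y [HA1 HA2] H.
  apply rescale_generator_limit in H.
  assert (Hd : dom A x) by (apply HA1; eauto).
  split; [exact Hd|]. simpl.
  rewrite (filterlim_locally_unique _ _ _ (HA2 x Hd) H).
  exact (minus_plus_opp (G := X) (scal lambda x) y).
Qed.

(** * Transfer of backward orbits *)

Lemma iter_commute :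
  forall (X : Type) (S B : X -> X) (n : nat) (x : X),
    (forall y, B (S y) = S (B y)) -> Nat.iter n B (S x) = S (Nat.iter n B x).
Proof.
  intros X S B n x H. induction n as [|n IH]; simpl; [reflexivity|].
  now rewrite IH, H.
Qed.

Lemma iter_norm_le :
  forall (X : NormedModule C_AbsRing) (B : X -> X) (M : R) (n : nat) (x : X),
    0 < M -> (forall y, norm (B y) <= M * norm y) ->
    norm (Nat.iter n B x) <= M ^ n * norm x.
Proof.
  intros X B M n x HM HB. induction n as [|n IH]; simpl; [lra|].
  eapply Rle_trans; [apply HB|]. rewrite Rmult_assoc.
  apply Rmult_le_compat_l; [lra | exact IH].
Qed.

(** The step common to both cores: if [Q B = S] and [B] commutes with [S], then a backward
    [S]-orbit [u] is turned into the backward [Q]-orbit with terms [B^n (u n)], since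
    [Q B^n (u n) = S B^(n-1) (u n) = B^(n-1) S (u n) = B^(n-1) (u (n-1))]. *)
Lemma iterated_preimages :
  forall (X : Type) (S B : X -> X) (Q : operator X) (u : nat -> X),
    (forall x, dom Q (B x) /\ app Q (B x) = S x) ->
    (forall x, B (S x) = S (B x)) ->
    (forall n, (1 <= n)%nat -> S (u n) = u (n - 1)%nat) ->
    forall n, (1 <= n)%nat ->
      dom Q (Nat.iter n B (u n)) /\
      app Q (Nat.iter n B (u n)) = Nat.iter (n - 1) B (u (n - 1)%nat).
Proof.
  intros X S B Q u HB Hcomm Hu n Hn.
  rewrite <- (Hu n Hn), (iter_commute X S B) by exact Hcomm.
  destruct n as [|n]; [lia|]. simpl. rewrite Nat.sub_0_r. apply HB.
Qed.

(** With [B x] the integral over [0, t] of [Cexp (lambda (t - s)) (T s x)], the product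
    [(lambda I - A) B] is [S = Cexp (lambda t) I - T t].  Below, the factor
    [Cexp (lambda t)] is applied to [x] before integrating the orbit of the rescaled
    semigroup [U]. *)
Lemma scalar_minus_factorization :
  forall (X : CompleteNormedModule C_AbsRing) (T : R -> X -> X) (A : operator X)
         (lambda : C) (t : R),
    C0_semigroup T -> is_generator T A -> 0 < t ->
    let S := app (scalar_minus (Cexp (lambda * RtoC t)) (everywhere_defined (T t))) in
    exists (B : X -> X) (M : R),
      (forall x, dom (scalar_minus lambda A) (B x) /\
                 app (scalar_minus lambda A) (B x) = S x) /\
      (forall x, B (S x) = S (B x)) /\
      0 < M /\ (forall x, norm (B x) <= M * norm x).
Proof.
  intros X T A lambda t HT HA Ht S.
  set (e := Cexp (lambda * RtoC t)).
  set (U := rescale X (- lambda) T).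
  assert (HU : C0_semigroup U) by now apply rescale_C0_semigroup.
  assert (HlT : is_linear (T t)) by (apply (C0_linear HT); lra).
  assert (He : is_linear (fun x : X => scal e x)).
  { apply (is_linear_scal_C X e (fun x => x)), is_linear_id. }
  assert (HlU : forall s, 0 <= s -> is_linear (U s)) by exact (C0_linear HU).
  assert (HlS : is_linear S) by now apply is_linear_minus.
  assert (HSU : forall s x, 0 <= s -> S (U s x) = U s (S x)).
  { intros s x Hs. unfold S; simpl.
    rewrite (linear_minus _ _ _ (HlU s Hs)), (linear_scal _ (HlU s Hs)).
    f_equal. apply rescale_commute; [exact HT | exact Hs | lra]. }
  destruct (orbit_integral_bounded X U t HU Ht) as (M & HM & HB).
  destruct (linear_norm _ He) as (M' & HM' & HeM).
  exists (fun x => orbit_integral X U t (scal e x)), (M * M').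
  split; [|split; [|split]].
  - intros x. apply (generator_scalar_minus X T A lambda _ (S x)); [exact HA|].
    replace (opp (S x)) with (minus (U t (scal e x)) (scal e x)).
    + now apply orbit_integral_generator.
    + rewrite (linear_scal _ (HlU t ltac:(lra))). unfold U, e.
      rewrite rescale_cancel. symmetry. apply @opp_minus.
  - intros x. rewrite <- (linear_scal _ HlS). symmetry.
    apply orbit_integral_commute; try assumption. lra.
  - now apply Rmult_lt_0_compat.
  - intros x. rewrite Rmult_assoc. eapply Rle_trans; [apply HB|].
    apply Rmult_le_compat_l; [lra | apply HeM].
Qed.

Theorem lemma2p3 :
  forall (X : CompleteNormedModule C_AbsRing) (T : R -> X -> X) (A : operator X),
    C0_semigroup T ->
    is_generator T A ->
    forall (lambda : C) (t : R), 0 < t ->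
      (forall x : X,
         analytic_core
           (scalar_minus (Cexp (Cmult lambda (RtoC t))) (everywhere_defined (T t))) x ->
         analytic_core (scalar_minus lambda A) x) /\
      (forall x : X,
         algebraic_core
           (scalar_minus (Cexp (Cmult lambda (RtoC t))) (everywhere_defined (T t))) x ->
         algebraic_core (scalar_minus lambda A) x).
Proof.
  intros X T A HT HA lambda t Ht.
  destruct (scalar_minus_factorization X T A lambda t HT HA Ht)
    as (B & M & HB & Hcomm & HM & HBM).
  split; intros x.
  - intros (u & delta & Hdelta & Hu0 & Hu).
    exists (fun n => Nat.iter n B (u n)), (M * delta).
    split; [now apply Rmult_lt_0_compat|]. split; [exact Hu0|]. intros n Hn.
    destruct (iterated_preimages X _ B (scalar_minus lambda A) u HB Hcomm
                (fun k Hk => proj1 (proj2 (Hu k Hk))) n Hn) as [Hdom Happ].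
    split; [exact Hdom|]. split; [exact Happ|].
    eapply Rle_trans; [now apply iter_norm_le with (M := M)|].
    rewrite Rpow_mult_distr, Rmult_assoc.
    apply Rmult_le_compat_l; [apply pow_le; lra | apply (Hu n Hn)].
  - intros (u & Hu0 & Hu).
    exists (fun n => Nat.iter n B (u n)). split; [exact Hu0|]. intros n Hn.
    exact (iterated_preimages X _ B (scalar_minus lambda A) u HB Hcomm
             (fun k Hk => proj2 (Hu k Hk)) n Hn).
Qed.
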